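(* Let $\mu$ be a nontrivial probability measure on the real line with finite moments of all nonnegative orders, let $\alpha_1,\dots,\alpha_M$ be distinct real numbers, let $M_1,\dots,M_M$ be nonnegative integers, and let $\lambda_{i,j}$ ($1\le i\le M$, $0\le j\le M_i$) be real numbers. Consider the discrete Sobolev inner product (symmetric bilinear form) on the space $\mathbb{P}$ of polynomials with real coefficients $$\langle f,g\rangle=\int f(t)g(t)\,d\mu(t)+\sum_{i=1}^{M}\sum_{j=0}^{M_i}\lambda_{i,j}f^{(j)}(\alpha_i)g^{(j)}(\alpha_i).$$ Put $$h(t)=\prod_{i=1}^{M}(t-\alpha_i)^{M_i+1},\qquad d\mu_0(t)=h(t)\,d\mu(t).$$ Then $\langle\cdot,\cdot\rangle$ is a multiple Geronimus transformation, with respect to $h$, of the bilinear form $(f,g)_0=\int f(t)g(t)\,d\mu_0(t)$; that is, for all $f,g\in\mathbb{P}$, $$\langle hf,g\rangle=\langle f,hg\rangle=\int f(t)g(t)\,d\mu_0(t).$$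
   Context: A measure is nontrivial if its support is infinite. Given a monic polynomial $h$ with real coefficients and a bilinear form $(f,g)_0=\int f(t)g(t)\,d\mu_0(t)$ on $\mathbb{P}$ (where $\mu_0$ may be a signed measure with finite moments), a multiple Geronimus transformation of $(\cdot,\cdot)_0$ with respect to $h$ is a symmetric bilinear form $[\cdot,\cdot]_h$ on $\mathbb{P}$ satisfying $[hf,g]_h=[f,hg]_h=\int f(t)g(t)\,d\mu_0(t)$ for all $f,g\in\mathbb{P}$. *)

(* Defs.v *)
From HB Require Import structures.
From mathcomp Require Import all_boot all_order all_algebra.
From mathcomp Require Import all_classical all_reals all_analysis.

Set Implicit Arguments.
Unset Strict Implicit.
Unset Printing Implicit Defensive.

Import Order.TTheory GRing.Theory Num.Theory.
Import numFieldNormedType.Exports.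

Local Open Scope classical_set_scope.
Local Open Scope ring_scope.

Definition measure_support (R : realType) (mu : {measure set R -> \bar R}) :
    set R :=
  [set x | forall U : set R, open_nbhs x U -> (0 < mu U)%E].

Definition nontrivial (R : realType) (mu : {measure set R -> \bar R}) : Prop :=
  infinite_set (measure_support mu).

Definition finite_moments (R : realType) (mu : {measure set R -> \bar R}) :
    Prop :=
  forall n : nat, mu.-integrable [set: R] (fun x => (x ^+ n)%:E).

Lemma integrable_poly (R : realType) (mu : {measure set R -> \bar R}) :
  finite_moments mu ->
  forall p : {poly R}, mu.-integrable [set: R] (fun x => p.[x]%:E).
Proof.
move=> mom p.
have -> : (fun x : R => p.[x]%:E) =
    (fun x => \sum_(i < size p) (p`_i)%:E * (x ^+ i)%:E)%E.
  apply/funext => x; rewrite horner_coef -sumEFin.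
  by apply: eq_bigr => i _; rewrite EFinM.
by apply: integrable_sum => // i _; exact: integrableZl.
Qed.

(* A Hahn decomposition of nu; the Jordan parts below do not depend on the one
   that is chosen (Hahn_decomposition_uniq). *)
Definition hahn_pos d (T : measurableType d) (R : realType)
    (nu : {charge set T -> \bar R}) : set T :=
  sval (cid (Hahn_decomposition nu)).

Definition hahn_neg d (T : measurableType d) (R : realType)
    (nu : {charge set T -> \bar R}) : set T :=
  sval (cid (svalP (cid (Hahn_decomposition nu)))).

Lemma hahnP d (T : measurableType d) (R : realType)
    (nu : {charge set T -> \bar R}) :
  hahn_decomposition nu (hahn_pos nu) (hahn_neg nu).
Proof. exact: svalP (cid (svalP (cid (Hahn_decomposition nu)))). Qed.

Definition charge_integrable d (T : measurableType d) (R : realType)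
    (nu : {charge set T -> \bar R}) (f : T -> R) : Prop :=
  (charge_variation (hahnP nu)).-integrable [set: T] (EFin \o f).

Definition charge_Rintegral d (T : measurableType d) (R : realType)
    (nu : {charge set T -> \bar R}) (f : T -> R) : R :=
  \int[jordan_pos (hahnP nu)]_x f x - \int[jordan_neg (hahnP nu)]_x f x.

Definition charge_finite_moments (R : realType)
    (nu : {charge set R -> \bar R}) : Prop :=
  forall n : nat, charge_integrable nu (fun x => x ^+ n).

Definition charge_form (R : realType) (nu : {charge set R -> \bar R})
    (f g : {poly R}) : R :=
  charge_Rintegral nu (fun t => f.[t] * g.[t]).

Definition symmetric_bilinear_form (R : realType)
    (B : {poly R} -> {poly R} -> R) : Prop :=
  [/\ commutative B,
      forall g, scalar (B ^~ g) &
      forall f, scalar (B f)].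

Definition multiple_Geronimus (R : realType) (nu : {charge set R -> \bar R})
    (h : {poly R}) (B : {poly R} -> {poly R} -> R) : Prop :=
  [/\ h \is monic,
      charge_finite_moments nu,
      symmetric_bilinear_form B &
      forall f g : {poly R},
        B (h * f) g = charge_form nu f g /\ B f (h * g) = charge_form nu f g].

Definition discrete_Sobolev (R : realType) (mu : {measure set R -> \bar R})
    (M : nat) (alpha : 'I_M -> R) (m : 'I_M -> nat)
    (lambda : forall i : 'I_M, 'I_(m i).+1 -> R) (f g : {poly R}) : R :=
  \int[mu]_t (f.[t] * g.[t]) +
  \sum_(i < M) \sum_(j < (m i).+1)
     lambda i j * f^`(j).[alpha i] * g^`(j).[alpha i].

Definition Sobolev_poly (R : realType) (M : nat) (alpha : 'I_M -> R)
    (m : 'I_M -> nat) : {poly R} :=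
  \prod_(i < M) ('X - (alpha i)%:P) ^+ (m i).+1.

Definition poly_charge (R : realType) (mu : {measure set R -> \bar R})
    (mom : finite_moments mu) (p : {poly R}) : {charge set R -> \bar R} :=
  induced_charge (integrable_poly mom p).

(* Main.v *)
Require Import Defs.
From mathcomp Require Import all_boot all_order all_algebra.
From mathcomp Require Import all_classical all_reals all_analysis.
From mathcomp Require Import measurable_realfun.

Set Implicit Arguments.
Unset Strict Implicit.
Unset Printing Implicit Defensive.

(** Every root [alpha i] of [h] has multiplicity at least [m i + 1], so all the
derivatives of [h * f] of order at most [m i] vanish at [alpha i]
([derivn_Sobolev_poly_mul]). The discrete part of the Sobolev product of
[h * f] and [g] is therefore zero, and what is left is the integral of
[h * f * g] against [mu]. Symmetry of the product carries this over to the
second argument.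

It remains to see that this integral is the integral of [f * g] against the
charge [mu0] of density [h], which is where the work lies, since integration
against a charge is defined through its Jordan parts. Let [P], [N] be a Hahn
decomposition of a charge of density [w]. Its positive part has density [w]
restricted to [P] and its negative part has density [- w] restricted to [N].
Integrating with respect to each of them ([integral_density]) and subtracting
gives the integral of [f * w] over [P] plus its integral over [N], that is over
the whole space ([charge_Rintegral_induced_charge]). The same densities reduce
the finiteness of the moments of [mu0] to the [mu]-integrability of polynomials
([charge_integrable_induced_charge]). *)

Import Order.TTheory GRing.Theory Num.Theory.
Local Open Scope classical_set_scope.
Local Open Scope ring_scope.

Section density.
Context d (T : measurableType d) (R : realType).
Variables (mu : {sigma_finite_measure set T -> \bar R})
  (nu : {finite_measure set T -> \bar R}) (w : T -> \bar R).
Hypothesis intw : mu.-integrable [set: T] w.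
Hypothesis nuE :
  forall A, measurable A -> nu A = (\int[mu]_(x in A) w x)%E.
Local Open Scope ereal_scope.

Lemma dominates_density : nu `<< mu.
Proof.
apply/null_content_dominatesP => A mA muA0; rewrite nuE//.
apply: null_set_integral => //.
apply: measurable_funTS; exact: measurable_int intw.
Qed.

(** [w] is only almost everywhere nonnegative and finite, whereas this version
of the Radon-Nikodym derivative is so at every point. *)
Let r := Radon_Nikodym_SigmaFinite.f nu mu.

Let intr : mu.-integrable [set: T] r.
Proof. exact/Radon_Nikodym_SigmaFinite.f_integrable/dominates_density. Qed.

Let rw_ae : ae_eq mu [set: T] r w.
Proof.
apply: integral_ae_eq => //; first exact: measurable_int intw.
move=> A _ mA; rewrite -nuE// -Radon_Nikodym_SigmaFinite.f_integral//.
exact: dominates_density.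
Qed.

(** No sign is asked of [w]: it agrees almost everywhere with the
Radon-Nikodym derivative of [nu]. This is what allows [w] to be a restriction
of a signed density to one side of a Hahn decomposition, on which its sign is
known only up to a null set. *)
Lemma integrable_density (f : T -> \bar R) : measurable_fun [set: T] f ->
  mu.-integrable [set: T] (f \* w) -> nu.-integrable [set: T] f.
Proof.
move=> mf /integrableP[mfw intfw]; apply/integrableP; split=> //.
rewrite -(@Radon_Nikodym_SigmaFinite.change_of_variables _ _ _ _ mu)//;
  [|exact: dominates_density|exact: measurableT_comp].
rewrite [ltLHS](_ : _ = \int[mu]_x `|f x * w x|)//.
have mr := measurable_int _ intr.
(* The pointwise nonnegativity of [r] lets it enter the absolute value, where it
   can be exchanged for [w]. *)
under eq_integral.
  move=> x _; rewrite -[X in _ * X]gee0_abs; last first.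
    exact/Radon_Nikodym_SigmaFinite.f_ge0/dominates_density.
  rewrite -abseM; over.
apply: ge0_ae_eq_integral => //.
- by apply: measurableT_comp => //; exact: emeasurable_funM.
- exact: measurableT_comp.
- by apply: filterS rw_ae => x /= rw xT; rewrite /r in rw; rewrite rw.
Qed.

Lemma integral_density (f : T -> \bar R) : measurable_fun [set: T] f ->
  mu.-integrable [set: T] (f \* w) ->
  \int[nu]_x f x = \int[mu]_x (f x * w x).
Proof.
move=> mf intfw.
have numu := dominates_density.
rewrite -(@Radon_Nikodym_change_of_variables _ _ _ nu mu)//;
  last exact: integrable_density.
apply: ae_eq_integral => //.
- exact: emeasurable_funM.
- exact: measurable_int intfw.
- apply: ae_eqe_mul2l; apply: ae_eq_trans rw_ae.
  exact/ae_eq_sym/ae_eq_Radon_Nikodym_SigmaFinite.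
Qed.

End density.

Section induced_charge_integral.
Context d (T : measurableType d) (R : realType).
Variables (mu : {sigma_finite_measure set T -> \bar R}) (w f : T -> R).
Hypothesis intw : mu.-integrable [set: T] (EFin \o w).
Hypothesis mf : measurable_fun [set: T] f.
Hypothesis intfw : mu.-integrable [set: T] (EFin \o (f \* w)).

Let nu : {charge set T -> \bar R} := induced_charge intw.
Let P := hahn_pos nu.
Let N := hahn_neg nu.

Let mP : measurable P.
Proof. by have [[]] := hahnP nu. Qed.

Let mN : measurable N.
Proof. by have [_ []] := hahnP nu. Qed.

Let jordan_pos_density A : measurable A ->
  jordan_pos (hahnP nu) A = (\int[mu]_(x in A) ((EFin \o w) \_ P) x)%E.
Proof.
move=> mA; rewrite jordan_posE cjordan_posE /crestr0 mem_set// /crestr.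
by rewrite -integral_mkcondr.
Qed.

Let jordan_neg_density A : measurable A ->
  jordan_neg (hahnP nu) A =
  (\int[mu]_(x in A) ((EFin \o (\- w)%R) \_ N) x)%E.
Proof.
move=> mA; rewrite jordan_negE cjordan_negE /crestr0 mem_set// /crestr.
have mAN : measurable (A `&` N) by exact: measurableI.
rewrite -integral_mkcondr -integralN//.
by apply: integrable_add_def => //; exact: integrableS intw.
Qed.

Let integrable_pos : mu.-integrable [set: T] ((EFin \o w) \_ P).
Proof. by apply/(integrable_mkcond _ mP); exact: integrableS intw. Qed.

Let integrable_neg : mu.-integrable [set: T] ((EFin \o (\- w)%R) \_ N).
Proof.
by apply/(integrable_mkcond _ mN); exact: integrableS (integrableN intw).
Qed.

Let mulr_patch (g : T -> R) (D : set T) :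
  ((EFin \o f) \* ((EFin \o g) \_ D))%E = (EFin \o (f \* g)) \_ D.
Proof.
by apply/funext => x; rewrite /= !patchE; case: ifPn => _; rewrite ?mule0.
Qed.

Let integrable_fpos :
  mu.-integrable [set: T] ((EFin \o f) \* ((EFin \o w) \_ P))%E.
Proof.
by rewrite mulr_patch; apply/(integrable_mkcond _ mP); exact: integrableS intfw.
Qed.

Let integrable_fneg :
  mu.-integrable [set: T] ((EFin \o f) \* ((EFin \o (\- w)%R) \_ N))%E.
Proof.
rewrite mulr_patch; apply/(integrable_mkcond _ mN).
apply: (@integrableS _ _ _ _ setT) => //.
rewrite [X in _.-integrable _ X](_ : _ = (\- (EFin \o (f \* w)%R))%E).
  exact: integrableN.
by apply/funext => x; rewrite /= mulrN.
Qed.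

Let mEf : measurable_fun [set: T] (EFin \o f).
Proof. exact/measurable_EFinP. Qed.

(** The variation of [nu] is the sum of its Jordan parts, so integrability
against it is checked on each part, where [f] times the density is a
restriction of [f * w] or of its opposite. *)
Lemma charge_integrable_induced_charge : charge_integrable nu f.
Proof.
have /integrableP[_ fpos] :=
  integrable_density integrable_pos jordan_pos_density mEf integrable_fpos.
have /integrableP[_ fneg] :=
  integrable_density integrable_neg jordan_neg_density mEf integrable_fneg.
apply/integrableP; split => //.
rewrite (eq_measure_integral
  (measure_add (jordan_pos (hahnP nu)) (jordan_neg (hahnP nu)))).
  rewrite ge0_integral_measure_add//; last exact: measurableT_comp.
  by rewrite lte_add_pinfty.
by move=> A mA _; exact/esym/measure_addE.
Qed.

(** The two minus signs, that of the negative Jordan part in the integral and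
that of its density [- w], cancel, so that the integrals of [f * w] over the two
sides of the Hahn decomposition add up. *)
Lemma charge_Rintegral_induced_charge :
  charge_Rintegral nu f = \int[mu]_x (f x * w x).
Proof.
have [_ _ PN PN0] := hahnP nu.
have posE : \int[jordan_pos (hahnP nu)]_x f x = \int[mu]_(x in P) (f x * w x).
  congr fine; rewrite (integral_density integrable_pos jordan_pos_density)//.
  transitivity (\int[mu]_x ((EFin \o (f \* w)%R) \_ P) x)%E.
    by rewrite -mulr_patch.
  by rewrite -integral_mkcond.
have negE :
    \int[jordan_neg (hahnP nu)]_x f x = - \int[mu]_(x in N) (f x * w x).
  rewrite /Rintegral -fineN -integralN; last first.
    by apply: integrable_add_def => //; exact: integrableS intfw.
  congr fine; rewrite (integral_density integrable_neg jordan_neg_density)//.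
  transitivity (\int[mu]_x ((EFin \o (f \* (\- w))%R) \_ N) x)%E.
    by rewrite -mulr_patch.
  by rewrite -integral_mkcond; apply: eq_integral => x _; rewrite /= mulrN.
rewrite /charge_Rintegral posE negE opprK.
by rewrite -Rintegral_setU ?PN//; exact/disj_set2P.
Qed.

End induced_charge_integral.

(** Each derivation lowers the multiplicity of the root [a] by at most one. *)
Lemma horner_derivn_XsubC_exp_mul (R : comNzRingType) (a : R) (n j : nat)
    (q : {poly R}) : (j < n)%N -> (('X - a%:P) ^+ n * q)^`(j).[a] = 0.
Proof.
elim: j n q => [|j IH] [//|n] q jn.
  by rewrite derivn0 exprS -mulrA hornerM hornerXsubC subrr mul0r.
(* By Leibniz' rule the derivative is again a multiple of the [n]-th power of
   ['X - a%:P], with a new cofactor to which the induction applies. *)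
rewrite derivSn derivM deriv_exp derivXsubC mul1r /=.
rewrite mulrnAl -mulrnAr [_ ^+ n.+1]exprSr -!mulrA -mulrDr.
exact: IH.
Qed.

Lemma derivn_Sobolev_poly_mul (R : realType) (M : nat) (alpha : 'I_M -> R)
    (m : 'I_M -> nat) (q : {poly R}) (i : 'I_M) (j : 'I_(m i).+1) :
  (Sobolev_poly alpha m * q)^`(j).[alpha i] = 0.
Proof.
rewrite /Sobolev_poly (bigD1 i)//= -mulrA.
exact: horner_derivn_XsubC_exp_mul.
Qed.

Lemma discrete_SobolevC (R : realType) (mu : {measure set R -> \bar R})
    (M : nat) (alpha : 'I_M -> R) (m : 'I_M -> nat)
    (lambda : forall i : 'I_M, 'I_(m i).+1 -> R) :
  commutative (discrete_Sobolev mu alpha lambda).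
Proof.
move=> f g; rewrite /discrete_Sobolev; congr (_ + _).
  by apply: eq_Rintegral => t _; rewrite mulrC.
by apply: eq_bigr => i _; apply: eq_bigr => j _; rewrite mulrAC.
Qed.

Lemma scalar_discrete_Sobolev (R : realType) (mu : {measure set R -> \bar R})
    (M : nat) (alpha : 'I_M -> R) (m : 'I_M -> nat)
    (lambda : forall i : 'I_M, 'I_(m i).+1 -> R) (f : {poly R}) :
  finite_moments mu -> scalar (discrete_Sobolev mu alpha lambda f).
Proof.
move=> mom a u v; rewrite /discrete_Sobolev.
have int g : mu.-integrable [set: R] (EFin \o (fun t => f.[t] * g.[t])).
  rewrite (_ : _ \o _ = fun t => (f * g).[t]%:E); first exact: integrable_poly.
  by apply/funext => t; rewrite /= hornerM.
have intZ : mu.-integrable [set: R] (EFin \o (fun t => a * (f.[t] * u.[t]))).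
  rewrite (_ : _ \o _ = fun t => (a%:E * (f.[t] * u.[t])%:E)%E)//.
  exact: integrableZl (int u).
under eq_Rintegral do rewrite hornerD hornerZ mulrDr mulrCA.
rewrite RintegralD// RintegralZl// mulrDr addrACA; congr (_ + _).
rewrite mulr_sumr -big_split; apply: eq_bigr => i _.
rewrite mulr_sumr -big_split; apply: eq_bigr => j _ /=.
by rewrite derivnD derivnZ hornerD hornerZ mulrDr mulrCA.
Qed.

Theorem theorem1 (R : realType) (mu : probability R R)
    (mu_nontrivial : nontrivial mu) (mu_moments : finite_moments mu)
    (M : nat) (alpha : 'I_M -> R) (alpha_inj : injective alpha)
    (m : 'I_M -> nat) (lambda : forall i : 'I_M, 'I_(m i).+1 -> R) :
  let h := Sobolev_poly alpha m in
  let mu0 := poly_charge mu_moments h in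
  multiple_Geronimus mu0 h (discrete_Sobolev mu alpha lambda).
Proof.
move=> h mu0.
have mpoly (p : {poly R}) : measurable_fun [set: R] (horner p).
  have /measurable_int := integrable_poly mu_moments p.
  by move=> /measurable_EFinP.
have intpoly (f p : {poly R}) :
    mu.-integrable [set: R] (EFin \o (horner f \* horner p)).
  rewrite (_ : _ \o _ = fun t => (f * p).[t]%:E); first exact: integrable_poly.
  by apply/funext => t; rewrite /= hornerM.
have SobC := discrete_SobolevC mu alpha lambda.
have Sobh f g : discrete_Sobolev mu alpha lambda (h * f) g = charge_form mu0 f g.
  rewrite /discrete_Sobolev /charge_form.
  rewrite big1 ?addr0 => [|i _]; last first.
    by rewrite big1// => j _; rewrite derivn_Sobolev_poly_mul mulr0 mul0r.
  transitivity (charge_Rintegral mu0 (horner (f * g))); last first.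
    by congr charge_Rintegral; apply/funext => t; rewrite hornerM.
  rewrite charge_Rintegral_induced_charge//.
  by apply: eq_Rintegral => t _; rewrite !hornerM -mulrA mulrC.
split.
- by apply: monic_prod => i _; exact/monic_exp/monicXsubC.
- move=> n; rewrite (_ : (fun x => x ^+ n) = horner 'X^n).
    exact: charge_integrable_induced_charge.
  by apply/funext => x; rewrite hornerXn.
- split=> // [g a u v|f]; last exact: scalar_discrete_Sobolev.
  by rewrite ![discrete_Sobolev _ _ _ _ g]SobC scalar_discrete_Sobolev.
- move=> f g; split; first exact: Sobh.
  rewrite SobC Sobh.
  by congr charge_Rintegral; apply/funext => t; rewrite mulrC.
Qed.
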